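(* Let $(E,\xi)=\mathrm{ind}(E_n,\xi_n)$ be an inductive limit of a sequence $(E_n,\xi_n)_{n\in\mathbb{N}}$ of locally convex spaces. For each $n\in\mathbb{N}$, let $S_n$ be a pointed convex cone in $(E_n,\xi_n)$ and let $W_n$ be a dilating cone of $S_n$ in $(E_n,\xi_n)$. Assume moreover that the sequence $(W_n)_{n\in\mathbb{N}}$ is non-conflicting. If $A\subset E_1$ is nonempty and countably compact in $(E_1,\xi_1)$, then the set of lastingly globally properly efficient points of $A$ with respect to the sequence $(S_n)_{n\in\mathbb{N}}$ is nonempty, i.e. $$\bigcap_{n=1}^{\infty} GHe_n(A,S_n)\neq\emptyset .$$ Equivalently, $$\bigcap_{n=1}^{\infty} GHE_n(A,S_n)\neq\emptyset .$$
   Context: A locally convex space means a real locally convex Hausdorff topological vector space. Inductive limit: $(E_1,\xi_1)\subset(E_2,\xi_2)\subset\cdots$ is an increasing sequence of locally convex spaces, each $E_n$ being a proper linear subspace of $E_{n+1}$ with continuous inclusion $(E_n,\xi_n)\to(E_{n+1},\xi_{n+1})$; $E=\bigcup_{n=1}^\infty E_n$, and $\xi$ is the finest locally convex topology on $E$ making all inclusions $(E_n,\xi_n)\to E$ continuous. It is assumed throughout that $(E,\xi)$ is Hausdorff. A cone is a set $S$ (containing $0$) with $\alpha s\in S$ for all $s\in S$, $\alpha\ge 0$; it is a convex cone if in addition $S+S\subset S$, and pointed if $S\cap(-S)=\{0\}$. For a set $B$, $\mathrm{cone}(B)=\{0\}\cup\{tb: t\ge 0,\ b\in B\}$. $\mathrm{int}_{\xi_n}$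 and $\mathrm{cl}_{\xi_n}$ denote interior and closure in $(E_n,\xi_n)$. A dilating cone of $S_n$ in $(E_n,\xi_n)$ is a convex cone $W_n\subset E_n$ with $S_n\setminus\{0\}\subset \mathrm{int}_{\xi_n}W_n$. A sequence of convex cones $W_n\subset E_n$ is non-conflicting if for each $n\in\mathbb{N}$, $$-W_j\not\subset \mathrm{cl}_{\xi_n}(W_1+W_2+\cdots+W_n)\quad\text{for all } j=1,2,\dots,n.$$ Let $A\subset E_1$ be nonempty and $a_0\in A$. (1) $a_0\in E(A,W)$ means $(A-a_0)\cap(-W)=\{0\}$. (2) $a_0\in GHe_n(A,S_n)$ (globally properly efficient in $(E_n,\xi_n,S_n)$) iff there exists a convex cone $W$ in $E_n$ such that $S_n\setminus\{0\}\subset\mathrm{int}_{\xi_n}W$ and $a_0\in E(A,W)$. A lastingly globally properly efficient point of $A$ with respect to $(S_n)_{n\in\mathbb{N}}$ is a point of $\bigcap_{n=1}^\infty GHe_n(A,S_n)$. (3) A base of $S_n$ is a convex set $\Theta_n\subset S_n$ with $S_n=\mathrm{cone}(\Theta_n)$ and $0\notin\mathrm{cl}_{\xi_n}(\Theta_n)$. $a_0\in GHE_n(A,S_n)$ (generalized Henig properly efficient in $(E_n,\xi_n,S_n)$) iff there exist a base $\Theta_n$ of $S_n$ and a convex $0$-neighborhood $V_n$ in $(E_n,\xi_n)$ such that $$\mathrm{cl}_{\xi_n}\big(\mathrm{cone}(A-a_0)\big)\cap\big(-\mathrm{cone}(\Theta_n+V_n)\big)=\{0\}.$$ A set is countably compact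 if every countable open cover of it has a finite subcover (equivalently, every sequence in it has a cluster point in it). *)

(* Defs.v *)
From HB Require Import structures.
From mathcomp Require Import all_boot all_order all_algebra.
From mathcomp Require Import all_classical all_reals all_analysis.
Set Implicit Arguments.
Unset Strict Implicit.
Unset Printing Implicit Defensive.
Import Order.TTheory GRing.Theory Num.Theory.
Local Open Scope classical_set_scope.
Local Open Scope ring_scope.

Section cones.
Context {R : realType} {X : lmodType R}.
Implicit Types (A B S : set X) (a : X).

Definition opp_set B : set X := [set - x | x in B].

Definition add_set A B : set X := [set x + y | x in A & y in B].

Definition translate A a : set X := [set x - a | x in A].

Definition is_cone S : Prop :=
  S 0 /\ forall (t : R) s, 0 <= t -> S s -> S (t *: s).

Definition convex_cone S : Prop :=
  is_cone S /\ forall s t, S s -> S t -> S (s + t).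

Definition pointed_set S : Prop := S `&` opp_set S = [set 0].

(* The point 0 is added explicitly so that the cone of the empty set is {0}. *)
Definition cone B : set X :=
  [set 0] `|` [set x | exists t b, [/\ 0 <= t, B b & x = t *: b]].

(* E(A, S) *)
Definition efficient A S : set X :=
  [set a | A a /\ translate A a `&` opp_set S = [set 0]].

End cones.

(* [cover_compact] restricted to countable covers. *)
Definition countably_compact (T : topologicalType) (A : set T) : Prop :=
  forall (I : choiceType) (D : set I) (f : I -> set T), countable D ->
    (forall i, D i -> open (f i)) -> A `<=` cover D f ->
    finite_subset_cover D f A.

Section proper_efficiency.
Context {R : realType} {X : tvsType R}.
Implicit Types (A S W Theta V : set X).

Definition dilating_cone S W : Prop :=
  convex_cone W /\ S `\ 0 `<=` interior W.

Definition cone_base S Theta : Prop :=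
  [/\ convex_set Theta, Theta `<=` S, S = cone Theta & ~ closure Theta 0].

Definition GHe A S : set X :=
  [set a | exists2 W, dilating_cone S W & efficient A W a].

Definition GHE A S : set X :=
  [set a | A a /\ exists Theta V,
    [/\ cone_base S Theta, convex_set V, nbhs 0 V &
        closure (cone (translate A a)) `&` opp_set (cone (add_set Theta V))
          = [set 0]]].

End proper_efficiency.

Unset Implicit Arguments.

Section inductive_limit.
Context {R : realType} {E_ : nat -> tvsType R} {E : tvsType R}.
Variable j : forall n, {linear E_ n -> E}.

(* The steps are indexed from 0: [E_ n] is the (n+1)-st space of the sequence.
   Each step is a type with its own topology, identified with the subspace
   [range (j n)] of E; no topology is transported along [j n], so the step
   topology need not be the one induced by E. *)
Record is_inductive_limit : Prop := IsInductiveLimit {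
  step_hausdorff : forall n, hausdorff_space (E_ n) ;
  step_inj : forall n, injective (j n) ;
  step_proper : forall n, range (j n) `<` range (j n.+1) ;
  step_incl_continuous : forall n, exists2 i : E_ n -> E_ n.+1,
    (forall x, j n.+1 (i x) = j n x) & continuous i ;
  limit_union : \bigcup_n range (j n) = setT ;
  limit_continuous : forall n, continuous (j n) ;
  (* A competing locally convex topology on E is given as a locally convex
     space T linearly identified with E by the bijection h. *)
  limit_finest : forall (T : tvsType R) (h : {linear E -> T}), bijective h ->
    (forall n, continuous (fun x : E_ n => h (j n x))) -> continuous h ;
  limit_hausdorff : hausdorff_space E }.

(* For m <= n, the subset B of [E_ m] seen as a subset of [E_ n]. *)
Definition seen_in (m n : nat) (B : set (E_ m)) : set (E_ n) :=
  j n @^-1` (j m @` B).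
Arguments seen_in {m} n B.

(* W_0 + ... + W_n in [E_ n] *)
Definition partial_sum (W : forall n, set (E_ n)) (n : nat) : set (E_ n) :=
  [set \sum_(i < n.+1) w i |
     w in [set w : 'I_n.+1 -> E_ n |
              forall i : 'I_n.+1, seen_in n (W i) (w i)]].

Definition nonconflicting (W : forall n, set (E_ n)) : Prop :=
  forall n k : nat, (k <= n)%N ->
    ~ (opp_set (seen_in n (W k)) `<=` closure (partial_sum W n)).

(* Points of E that belong to every [P n], with [P n] a subset of [E_ n]. *)
Definition lasting (P : forall n, set (E_ n)) : set E :=
  \bigcap_n (j n @` P n).

End inductive_limit.

Arguments seen_in {R E_ E} j {m} n B.

(* Main.v *)
Require Import Defs.
From HB Require Import structures.
From mathcomp Require Import all_boot all_order all_algebra.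
From mathcomp Require Import all_classical all_reals all_analysis.
From mathcomp Require Import lra.
Set Implicit Arguments.
Unset Strict Implicit.
Unset Printing Implicit Defensive.
Import Order.TTheory GRing.Theory Num.Theory.
Local Open Scope classical_set_scope.
Local Open Scope ring_scope.

(** The key is to find one point [a] of [A] such that, for every [n], no
    difference [a - x] with [x] in [A] lies in the interior of [W n]. Such a
    point minimizes a single function over [A].

    Let [Z], a convex cone in the limit space, be the union of the sums
    [W 0 + ... + W n], let [m] be the least index such that [W m] has an interior
    point, and let [e] be such a point. Because the cones do not conflict, [- e]
    is not in [Z] ([interior_not_opp_sum_cone]); because [e] is interior to
    [W m], it is in the algebraic interior of the trace of [Z] on [E_ m]. Hence
    the height [x |-> sup {t | x - t e in Z}] is finite and superlinear on
    [E_ m], with height 1 at [e], and it is lower semicontinuous on [E_ 0]. It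
    plays the part of a positive functional, so that no separation theorem is
    needed. Any point [d] of the interior of some [W k] has [d - t e] in [W k]
    for some [t > 0], since [m <= k]; adding [d] therefore strictly raises the
    height. So a minimizer of the height over [A], which exists by countable
    compactness ([countably_compact_min]), is the wanted point
    ([exists_common_efficient]).

    For such a point [a], the cone [{0} U int (W n)] witnesses global proper
    efficiency. For the generalized Henig version, the set of [s] in [S n] with
    [s - e'] in [W n], where [e'] is a nonzero element of [S n], is a base whose
    sum with a small neighborhood of 0 stays in the interior of [W n]; the
    opposite of that interior is open and disjoint from the cone of [A - a],
    hence also from its closure. *)

(** * Convex cones *)

Section convex_cones.
Context {R : realType} {X : lmodType R}.
Implicit Types (C : set X) (x y e : X).

Lemma convex_cone0 C : convex_cone C -> C 0.
Proof. by move=> [[]]. Qed.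

Lemma convex_coneD C x y : convex_cone C -> C x -> C y -> C (x + y).
Proof. by move=> [_]; exact. Qed.

Lemma convex_coneZ C (t : R) x : convex_cone C -> 0 <= t -> C x -> C (t *: x).
Proof. by move=> [[_ +] _]; exact. Qed.

Lemma convex_set_comb C :
  (forall (t : R) x y, 0 <= t -> t <= 1 -> C x -> C y ->
    C (t *: x + (1 - t) *: y)) -> convex_set C.
Proof.
by move=> H x y l /[!inE] Cx Cy; exact: H.
Qed.

(** The height of [x] above the cone in the direction [e]: for a convex cone
    with [e] in its algebraic interior and [- e] outside of it, this is a
    finite superlinear function. *)
Definition height C e x : R := sup [set t | C (x - t *: e)].

Lemma height_has_sup C e x : convex_cone C -> ~ C (- e) ->
  (exists2 t : R, 0 < t & C (e + t *: x)) ->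
  (exists2 t : R, 0 < t & C (e - t *: x)) ->
  has_sup [set t | C (x - t *: e)].
Proof.
move=> cC Ce [t t0 Ct] [u u0 Cu]; split.
  exists (- t^-1) => /=; rewrite scaleNr opprK.
  have -> : x + t^-1 *: e = t^-1 *: (e + t *: x).
    by rewrite scalerDr scalerA mulVf ?gt_eqF// scale1r addrC.
  by apply: convex_coneZ => //; rewrite invr_ge0 ltW.
exists u^-1 => s /= Cs; rewrite leNgt; apply/negP => us; apply: Ce.
have d0 : 0 < s - u^-1 by rewrite subr_gt0.
have -> : - e = (s - u^-1)^-1 *: ((x - s *: e) + u^-1 *: (e - u *: x)).
  have -> : x - s *: e + u^-1 *: (e - u *: x) = - ((s - u^-1) *: e).
    rewrite scalerBr scalerA mulVf ?gt_eqF// scale1r addrC addrA subrK.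
    by rewrite -scalerBl -scaleNr opprB.
  by rewrite scalerN scalerA mulVf ?gt_eqF// scale1r.
apply: convex_coneZ => //; first by rewrite invr_ge0 ltW.
by apply: convex_coneD => //; apply: convex_coneZ => //; rewrite invr_ge0 ltW.
Qed.

Lemma height_ge C e x t : has_sup [set t | C (x - t *: e)] ->
  C (x - t *: e) -> t <= height C e x.
Proof. by move=> /sup_upper_bound + Ct; exact. Qed.

Lemma height_gt_ex C e x c : has_sup [set t | C (x - t *: e)] ->
  c < height C e x -> exists2 t, c < t & C (x - t *: e).
Proof.
move=> sx; rewrite -subr_gt0 => /sup_adherent /(_ sx)[t Ct].
by rewrite subKr => ct; exists t.
Qed.

(** Adding [d *: e] and an element of the cone raises the height by at least
    [d]. *)
Lemma height_lt C e x y d : convex_cone C ->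
  has_sup [set t | C (x - t *: e)] -> has_sup [set t | C (y - t *: e)] ->
  0 < d -> C (x - y - d *: e) -> height C e y < height C e x.
Proof.
move=> cC sx sy d0 Cd.
apply: (@lt_le_trans _ _ (height C e y + d)); first by rewrite ltrDl.
rewrite -lerBrDr; apply: ge_sup; first by case: sy.
move=> t /= Ct; rewrite lerBrDr; apply: height_ge => //.
have -> : x - (t + d) *: e = (x - y - d *: e) + (y - t *: e); last first.
  exact: convex_coneD.
by rewrite scalerDl opprD addrACA subrK [- _ - _]addrC.
Qed.

End convex_cones.

(** * Minimization on countably compact sets *)

Lemma seq_min_mem d (T : orderType d) (s : seq T) (x : T) : x \in s ->
  exists2 m, m \in s & forall y, y \in s -> (m <= y)%O.
Proof.
elim: s x => // y s IH x _.
have [->|[z zs]] : s = [::] \/ exists z, z \in s.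
  by case: s {IH} => [|z s]; [left|right; exists z; rewrite mem_head].
  by exists y; rewrite ?mem_head// => z; rewrite inE => /eqP ->.
have [m ms mmin] := IH _ zs.
have [ym|my] := leP y m.
  exists y; rewrite ?mem_head// => u; rewrite inE => /predU1P[->//|us].
  exact: le_trans ym (mmin _ us).
exists m; first by rewrite inE ms orbT.
by move=> u; rewrite inE => /predU1P[->|/mmin//]; exact: ltW.
Qed.

(** If the minimum is not attained, the open sets [q < g] with [q] a rational
    bound that is violated somewhere on the set form a countable cover; a finite
    subcover would have a least bound, violated nowhere. *)
Lemma countably_compact_min (R : realType) (T : topologicalType) (A : set T)
    (g : T -> R) : countably_compact A -> A !=set0 ->
  (forall c, open [set x | c < g x]) ->
  exists2 a, A a & forall x, A x -> g a <= g x.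
Proof.
move=> cA [x0 Ax0] og; apply: contrapT => nmin.
have lower x : A x -> exists2 y, A y & g y < g x.
  move=> Ax; apply: contrapT => nlt; apply: nmin; exists x => // y Ay.
  by rewrite leNgt; apply/negP => gyx; apply: nlt; exists y.
pose D : set rat := [set q | exists2 y, A y & g y <= ratr q].
have AD : A `<=` cover D (fun q => [set x | ratr q < g x]).
  move=> x Ax; have [y Ay /rat_in_itvoo[q]] := lower _ Ax.
  by rewrite in_itv => /andP[yq qx]; exists q => //; exists y => //; exact: ltW.
have [F FD AF] := cA _ D _ (countableP _) (fun q _ => og (ratr q)) AD.
have [q0 q0F _] := AF _ Ax0.
have [m mF mmin] := seq_min_mem q0F.
have [y Ay] : D m by have := FD _ mF; rewrite inE.
have [q qF /= qy ym] := AF _ Ay.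
by have := lt_le_trans qy ym; rewrite ltr_rat ltNge mmin.
Qed.

(** * Interiors of convex cones in a locally convex space *)

Section topological_cones.
Context {R : realType} {X : tvsType R}.
Implicit Types (C U : set X) (x y e : X).

Lemma interiorDl C x y : convex_cone C -> C x -> interior C y ->
  interior C (x + y).
Proof.
move=> cC Cx /(nbhsB x); apply: filterS => z [u Cu <-].
exact: convex_coneD.
Qed.

Lemma interiorZ C (t : R) x : convex_cone C -> 0 < t -> interior C x ->
  interior C (t *: x).
Proof.
move=> cC t0 /(nbhsZ (lt0r_neq0 t0)); apply: filterS => z [u Cu <-].
by apply: convex_coneZ => //; exact: ltW.
Qed.

Lemma nbhs_opp U x : nbhs (- x) U -> nbhs x [set y | U (- y)].
Proof.
have n1 : -1 != 0 :> R by rewrite oppr_eq0 oner_eq0.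
move=> /(nbhsZ n1); rewrite scaleN1r opprK; apply: filterS => _ [u Uu <-] /=.
by rewrite scaleN1r opprK.
Qed.

Lemma nbhs_addl U x y : nbhs (x + y) U -> nbhs y [set z | U (x + z)].
Proof.
move=> /(nbhsB (- x)); rewrite addKr; apply: filterS => _ [u Uu <-] /=.
by rewrite addNKr.
Qed.

(** Interior points are algebraic interior points. *)
Lemma interior_absorb U e v : interior U e ->
  exists2 t : R, 0 < t & U (e + t *: v).
Proof.
move=> Ue; have /= Ue0 : nbhs (e + (0 : R) *: v) U by rewrite scale0r addr0.
have /nbhs_addl/= Us := Ue0.
have := @scale_continuous _ X (0, v) _ Us.
case=> -[B1 B2] /= [[r /= r0 rB] vB] BU.
exists (r / 2); first by rewrite divr_gt0.
apply: (BU (r / 2, v)); split => /=; last exact: nbhs_singleton.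
apply: rB; rewrite /ball_ /= sub0r normrN gtr0_norm ?divr_gt0//.
by rewrite ltr_pdivrMr// mulr_natr mulr2n ltrDl.
Qed.

Lemma locally_convex_nbhs U x : nbhs x U ->
  exists V, [/\ convex_set V, nbhs x V & V `<=` U].
Proof.
have [B cB [oB bB]] := @locally_convex R X.
move=> /bB[V [BV Vx] VU]; exists V; split => //.
- by apply: cB; rewrite inE.
- by apply: open_nbhs_nbhs; split => //; exact: oB.
Qed.

End topological_cones.

(** * Sums of the dilating cones in the limit space *)

Section limit_cones.
Context {R : realType} {E_ : nat -> tvsType R} {E : tvsType R}.
Context (j : forall n, {linear E_ n -> E}) (S W : forall n, set (E_ n)).
Arguments S : clear implicits.
Arguments W : clear implicits.
Context (limE : is_inductive_limit j).
Context (dilW : forall n, dilating_cone (S n) (W n)).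
Context (ncW : nonconflicting j W).

Let coneW n : convex_cone (W n) := (dilW n).1.

Lemma step_incl m n : (m <= n)%N -> exists2 i : E_ m -> E_ n,
  (forall x, j n (i x) = j m x) & continuous i.
Proof.
elim: n => [|n IH]; first by rewrite leqn0 => /eqP ->; exists id => // x; exact.
rewrite leq_eqVlt => /predU1P[->|]; first by exists id => // x; exact.
rewrite ltnS => /IH[i ji ci]; have [i' ji' ci'] := step_incl_continuous _ limE n.
exists (i' \o i) => [x|x]; first by rewrite /= ji' ji.
by apply: continuous_comp; [exact: ci|exact: ci'].
Qed.

(** The sum [W 0 + ... + W (n - 1)] of the images of the first [n] cones in the
    limit space. *)
Fixpoint sum_cone n : set E :=
  if n is n'.+1 then add_set (sum_cone n') (j n' @` W n') else [set 0].

Lemma convex_sum_cone n : convex_cone (sum_cone n).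
Proof.
elim: n => [|n IH] /=.
  split=> [|x y -> ->]; last by rewrite /= addr0.
  by split=> // t x _ ->; rewrite /= scaler0.
split; [split|].
- exists 0; first exact: convex_cone0 IH.
  by exists 0; [exists 0; [exact: convex_cone0 (coneW n)|exact: linear0]|
    rewrite addr0].
- move=> t _ t0 [x Zx [_ [w Ww <-] <-]]; exists (t *: x).
    exact: convex_coneZ.
  exists (t *: j n w); last by rewrite scalerDr.
  by exists (t *: w); [exact: convex_coneZ|exact: linearZ].
- move=> _ _ [x Zx [_ [w Ww <-] <-]] [y Zy [_ [v Wv <-] <-]].
  exists (x + y); first exact: convex_coneD.
  exists (j n w + j n v); last by rewrite addrACA.
  by exists (w + v); [exact: convex_coneD|exact: linearD].
Qed.

Lemma sum_coneS n : sum_cone n `<=` sum_cone n.+1.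
Proof.
move=> x Zx; exists x => //; exists 0; last by rewrite addr0.
by exists 0; [exact: convex_cone0 (coneW n)|exact: linear0].
Qed.

Lemma sum_cone_sub m n : (m <= n)%N -> sum_cone m `<=` sum_cone n.
Proof.
elim: n => [|n IH]; first by rewrite leqn0 => /eqP ->.
rewrite leq_eqVlt => /predU1P[->//|]; rewrite ltnS => /IH mn.
by move=> x /mn; exact: sum_coneS.
Qed.

Lemma sub_sum_cone n w : W n w -> sum_cone n.+1 (j n w).
Proof.
move=> Ww; exists 0; first exact: convex_cone0 (convex_sum_cone n).
by exists (j n w); [exists w|rewrite add0r].
Qed.

Lemma sum_coneP n x : sum_cone n x -> exists2 w : nat -> E,
  (forall i, (j i @` W i) (w i)) & x = \sum_(i < n) w i.
Proof.
elim: n x => [|n IH] x /=.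
  move=> ->; exists (fun=> 0); last by rewrite big_ord0.
  by move=> i; exists 0; [exact: convex_cone0 (coneW i)|exact: linear0].
move=> [_ /IH[w Ww ->] [y Wy <-]].
exists (fun i => if i == n then y else w i).
  by move=> i; case: eqP => [->|_]; [exact: Wy|exact: Ww].
rewrite big_ord_recr /= eqxx; congr (_ + _); apply: eq_bigr => i _.
by rewrite ltn_eqF.
Qed.

Lemma sum_cone_partial_sum n (y : E_ n) :
  sum_cone n.+1 (j n y) -> partial_sum j W n y.
Proof.
move=> /sum_coneP[w Ww ywE].
have /choice[v jv] (i : 'I_n.+1) : exists v : E_ n, j n v = w i.
  have [x _ <-] := Ww i; have [i' ji' _] := step_incl (ltn_ord i : (i <= n)%N).
  by exists (i' x).
exists v; first by move=> i; rewrite /seen_in /= jv; exact: Ww.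
apply: (step_inj _ limE n); rewrite ywE linear_sum.
by apply: eq_bigr => i _; rewrite -[RHS]jv.
Qed.

(** If the opposite of an interior point [e] of [W k] were a sum of elements of
    the cones, then every [- w] with [w] in [W k] would be one too, because
    [e - t *: w] is in [W k] for some positive [t]; the cones would conflict. *)
Lemma interior_not_opp_sum_cone k e n :
  interior (W k) e -> ~ sum_cone n (- j k e).
Proof.
move=> We Ze; pose m := maxn n k.
have km : (k <= m)%N by rewrite leq_maxr.
have Zme : sum_cone m.+1 (- j k e).
  by apply: sum_cone_sub Ze; rewrite leqW// leq_maxl.
apply: (ncW km) => _ [y [w Ww jwy] <-]; apply: subset_closure.
apply: sum_cone_partial_sum; rewrite linearN /= -jwy.
have [t t0] := interior_absorb (- w) We; rewrite scalerN => /sub_sum_cone Zt.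
have -> : - j k w = t^-1 *: (- j k e + j k (e - t *: w)).
  rewrite linearB addKr linearZ /= scalerN scalerA mulVf ?gt_eqF//.
  by rewrite scale1r.
have cZ := convex_sum_cone m.+1.
apply: (convex_coneZ cZ); first by rewrite invr_ge0 ltW.
by apply: (convex_coneD cZ) => //; exact: sum_cone_sub Zt.
Qed.

Lemma interior_cone_neq0 k : ~ interior (W k) 0.
Proof.
by move=> /(@interior_not_opp_sum_cone _ _ 0); apply; rewrite linear0 oppr0.
Qed.

(** The sums of finitely many elements of the cones, in the limit space. *)
Definition all_cone : set E := \bigcup_n sum_cone n.

Lemma convex_all_cone : convex_cone all_cone.
Proof.
split; [split|].
- by exists 0%N.
- move=> t s t0 [n _ Zs]; exists n => //.
  exact: (convex_coneZ (convex_sum_cone n)).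
- move=> x y [n _ Zx] [m _ Zy]; exists (maxn n m) => //.
  apply: (convex_coneD (convex_sum_cone _)).
    by apply: sum_cone_sub Zx; exact: leq_maxl.
  by apply: sum_cone_sub Zy; exact: leq_maxr.
Qed.

Lemma sub_all_cone n w : W n w -> all_cone (j n w).
Proof. by move=> Ww; exists n.+1 => //; exact: sub_sum_cone. Qed.

(** Let [m] be the least index such that [W m] has an interior point [e]. The
    height above [all_cone] in the direction [e] is lower semicontinuous on
    [E_ 0] because [e] is interior in [E_ m], and adding an interior point of
    [W k] strictly raises it because [m <= k]. A minimizer of the height over [A]
    is the wanted point. *)
Lemma exists_common_efficient (A : set (E_ 0%N)) :
  A !=set0 -> countably_compact A -> exists2 a, A a &
  forall k x (d : E_ k), A x -> j k d = j 0%N a - j 0%N x -> ~ interior (W k) d.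
Proof.
move=> A0 cA.
have [exW|noW] := pselect (exists n, `[< interior (W n) !=set0 >]); last first.
  have [a Aa] := A0; exists a => // k x d _ _ Wd; apply: noW.
  by exists k; apply/asboolP; exists d.
have [m /asboolP[e We] mmin] := ex_minnP exW.
pose Z := all_cone; pose je := j m e.
have cZ : convex_cone Z := convex_all_cone.
have Zje : ~ Z (- je) by move=> [n _]; exact: interior_not_opp_sum_cone.
have [i ji ci] := step_incl (leq0n m).
have hs x : has_sup [set t | Z (j 0%N x - t *: je)].
  apply: height_has_sup => //; have [t t0 Wt] := interior_absorb (i x) We.
    by exists t => //; have := sub_all_cone Wt; rewrite linearD linearZ /= ji.
  have [u u0 Wu] := interior_absorb (- i x) We.
  exists u => //; have := sub_all_cone Wu.
  by rewrite linearD linearZ /= linearN /= ji scalerN.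
have near_shift x d : 0 < d -> nbhs x [set y | Z (j 0%N y - j 0%N x + d *: je)].
  move=> d0.
  have Wdx : nbhs (d *: e - i x + i x) (W m).
    by rewrite subrK; exact: interiorZ (coneW m) d0 We.
  have : nbhs x [set y | W m (d *: e - i x + i y)] := ci x _ (nbhs_addl Wdx).
  apply: filterS => y /=.
  move=> /sub_all_cone; rewrite !linearD /= linearN linearZ /= !ji.
  by rewrite addrC [_ - j 0%N x]addrC addrA.
have [c|a Aa amin] := @countably_compact_min R _ A
    (fun x => height Z je (j 0%N x)) cA A0.
  rewrite openE => x /= /(height_gt_ex (hs x))[t ct Zt].
  have d0 : 0 < (t - c) / 2 by rewrite divr_gt0// subr_gt0.
  apply: filterS (near_shift x _ d0) => y /= Zy.
  apply: (@lt_le_trans _ _ (t - (t - c) / 2)); first by lra.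
  apply: height_ge (hs y) _.
  have := convex_coneD cZ Zt Zy; rewrite scalerBl opprB.
  by rewrite addrACA [_ + (_ - _)]addrC subrK [- _ + _]addrC.
exists a => // k x d Ax dE Wd.
have mk : (m <= k)%N by apply: mmin; apply/asboolP; exists d.
have [i' ji' _] := step_incl mk.
have [t t0 Wt] := interior_absorb (- i' e) Wd.
have := amin _ Ax; rewrite leNgt => /negP; apply.
apply: (height_lt cZ (hs a) (hs x) t0).
by have := sub_all_cone Wt; rewrite linearD linearZ /= linearN /= ji' scalerN dE.
Qed.

End limit_cones.

(** * Properly efficient points *)

Section proper_efficiency.
Context {R : realType} {X : tvsType R}.
Implicit Types (A S W : set X) (a : X).

Lemma interior_disjoint_GHe S W A a :
  dilating_cone S W -> A a ->
  (forall x, A x -> ~ interior W (a - x)) -> GHe A S a.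
Proof.
move=> [cW SW] Aa nW; exists ([set 0] `|` interior W).
  split.
    split; [split; [by left|]|].
      move=> t w; rewrite le_eqVlt => /predU1P[<-|t0]; first by left; exact: scale0r.
      by case=> [->|Ww]; [left; exact: scaler0|right; exact: interiorZ].
    move=> x y [->|Wx]; first by rewrite add0r.
    move=> [->|Wy]; first by rewrite addr0; right.
    by right; apply: interiorDl => //; exact: interior_subset Wx.
  by move=> s /SW /nbhs_interior; apply: filterS => y Wy; right.
split=> //; apply/seteqP; split=> [_ [[x Ax <-] [w [->|Ww] wE]]|_ ->].
- by rewrite -wE oppr0.
- by exfalso; apply: (nW _ Ax); rewrite -opprB -wE opprK.
- split; first by exists a => //; exact: subrr.
  by exists 0; [left|exact: oppr0].
Qed.

(** The base consists of those [s] in [S] for which [s - e] is in [W], with [e] a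
    nonzero element of [S]. The interior of [- W] is disjoint from the cone of
    [A - a]; being open, it is also disjoint from the closure of that cone. *)
Lemma interior_disjoint_GHE S W A a :
  convex_cone S -> dilating_cone S W -> ~ interior W 0 -> A a ->
  (forall x, A x -> ~ interior W (a - x)) -> GHE A S a.
Proof.
move=> cS [cW SW] W0 Aa nW; split=> //.
have A0 : closure (cone (translate A a)) 0 by apply: subset_closure; left.
have [[e [Se e0]]|trivS] := pselect (exists e, S e /\ e <> 0); last first.
  (* the base of the trivial cone is empty *)
  exists set0, setT; split.
  - split.
    + by apply: convex_set_comb.
    + by [].
    + apply/seteqP; split=> [s Ss|s [->|[t [b []]]]//]; last exact: convex_cone0.
      by left; apply: contrapT => s0; apply: trivS; exists s.
    + by rewrite closure0.
  - by apply: convex_set_comb.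
  - exact: filterT.
  - apply/seteqP; split=> [x [_ [_ [->|[t [b [_ [y []]]]]//] <-]]|x ->].
      exact: oppr0.
    by split=> //; exists 0; [left|exact: oppr0].
have We : interior W e by exact: SW.
have [V [cV V0 VW]] : exists V, [/\ convex_set V, nbhs 0 V &
    V `<=` [set v | interior W (e + v)]].
  by apply/locally_convex_nbhs/nbhs_addl/nbhs_interior; rewrite addr0.
exists [set s | S s /\ W (s - e)], V; split=> //; first split.
- apply: convex_set_comb => t x y t0 t1 [Sx Wx] [Sy Wy]; split.
    apply: (convex_coneD cS); apply: (convex_coneZ cS) => //.
    by rewrite subr_ge0.
  have -> : t *: x + (1 - t) *: y - e = t *: (x - e) + (1 - t) *: (y - e).
    by rewrite !scalerBr addrACA -opprD -scalerDl subrKC scale1r.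
  apply: (convex_coneD cW); apply: (convex_coneZ cW) => //.
  by rewrite subr_ge0.
- by move=> s [].
- apply/seteqP; split=> [s Ss|s [->|[t [b [t0 [Sb _] ->]]]]]; last 2 first.
  + exact: convex_cone0.
  + exact: convex_coneZ.
  have [->|s0] := eqVneq s 0; first by left.
  have Ws : interior W s by apply: SW; split=> //; exact/eqP.
  have [t t0 Wt] := interior_absorb (- e) Ws.
  right; exists t, (t^-1 *: s); split; first exact: ltW.
    split; first by apply: convex_coneZ => //; rewrite invr_ge0 ltW.
    have -> : t^-1 *: s - e = t^-1 *: (s + t *: - e).
      by rewrite scalerDr scalerA mulVf ?gt_eqF// scale1r.
    by apply: convex_coneZ => //; rewrite invr_ge0 ltW.
  by rewrite scalerA divff ?gt_eqF// scale1r.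
- (* otherwise if 0 were in the closure of the base, [W] would contain [b - e] and
     [2^-1 *: e - b] for some [b], hence [- e], and 0 would be interior to [W] *)
  have h0 : 0 < 2^-1 :> R by rewrite invr_gt0.
  have Wh : interior W (2^-1 *: e - 0) by rewrite subr0; exact: interiorZ.
  have : nbhs 0 [set b | W (2^-1 *: e - b)].
    exact: (nbhs_opp (nbhs_addl Wh)).
  move=> Wn /(_ _ Wn)[b [[_ Wb] Wbe]]; apply: W0.
  have -> : 0 = - e + e by rewrite addNr.
  apply: interiorDl => //.
  have -> : - e = 2 *: ((b - e) + (2^-1 *: e - b)).
    rewrite [b - e]addrC addrACA subrr addr0 scalerDr scalerA mulfV ?pnatr_eq0//.
    by rewrite scale1r scalerN scaler_nat mulr2n opprD subrK.
  by apply: (convex_coneZ cW) => //; exact: (convex_coneD cW).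
- apply/seteqP; split=> [y [Ay [_ [->|[t [b [t0 [s [Ss Ws] [v Vv <-]] ->]]]] yE]]|_ ->].
  + by rewrite -yE oppr0.
  + move: t0; rewrite le_eqVlt => /predU1P[t0|t0].
      by rewrite -yE -t0 scale0r oppr0.
    exfalso.
    have Wy : nbhs (- y) (interior W).
      rewrite -yE opprK; apply/nbhs_interior/interiorZ => //.
      have -> : s + v = (s - e) + (e + v) by rewrite addrA subrK.
      by apply: interiorDl => //; exact: VW.
    have [z [+ Wz]] := Ay _ (nbhs_opp Wy).
    case=> [z0|[u [_ [u0 [x Ax <-] zE]]]].
      by apply: W0; rewrite -oppr0 -z0.
    move: u0 Wz; rewrite le_eqVlt zE => /predU1P[<-|u0].
      by rewrite /= scale0r oppr0.
    rewrite /= -scalerN opprB => Wz; apply: (nW _ Ax).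
    rewrite -[a - x]scale1r -(mulVf (lt0r_neq0 u0)) -scalerA.
    by apply: interiorZ => //; rewrite invr_gt0.
  + by split=> //; exists 0; [left|exact: oppr0].
Qed.

End proper_efficiency.

Theorem theorem3p1 (R : realType) (E_ : nat -> tvsType R) (E : tvsType R)
    (j : forall n, {linear E_ n -> E})
    (S W : forall n, set (E_ n)) (A : set (E_ 0%N))
    (limE : is_inductive_limit j)
    (coneS : forall n, convex_cone (S n)) (pointedS : forall n, pointed_set (S n))
    (dilW : forall n, dilating_cone (S n) (W n))
    (ncW : nonconflicting j W)
    (A0 : A !=set0) (cA : countably_compact A) :
  lasting j (fun n => GHe (seen_in j n A) (S n)) !=set0 /\
  lasting j (fun n => GHE (seen_in j n A) (S n)) !=set0.
Proof.
have [a Aa aW] := exists_common_efficient limE dilW ncW A0 cA.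
have step n : exists b : E_ n, [/\ j n b = j 0%N a, seen_in j n A b &
    forall y, seen_in j n A y -> ~ interior (W n) (b - y)].
  have [i ji _] := step_incl limE (leq0n n).
  exists (i a); split=> [||y [x Ax jxy]]; first exact: ji.
    by exists a.
  by apply: (aW _ x) => //; rewrite linearB /= ji jxy.
split; exists (j 0%N a) => n _; have [b [jb Ab bW]] := step n; exists b => //.
  exact: interior_disjoint_GHe (dilW n) Ab bW.
apply: interior_disjoint_GHE (coneS n) (dilW n) _ Ab bW.
by move=> W0; exact: (interior_cone_neq0 limE dilW ncW W0).
Qed.
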